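(* Let $(A,\nu,\alpha)$ be a regular Hom-pre-Lie algebra over a field $\mathbb{K}$ of characteristic zero. If $\widetilde{H}^2(A,A)=0$, then every formal deformation of $A$ is equivalent to the trivial deformation, that is, $A$ is rigid.
   Context: $\mathbb{K}$ is a field of characteristic zero. A Hom-pre-Lie algebra $(A,\nu,\alpha)$, $\nu(a,b)=a\cdot b$, is a $\mathbb{K}$-vector space $A$ with a bilinear product $\cdot$ and a linear map $\alpha:A\to A$ such that for all $a,b,c\in A$: $(a\cdot b)\cdot\alpha(c)-\alpha(a)\cdot(b\cdot c)=(b\cdot a)\cdot\alpha(c)-\alpha(b)\cdot(a\cdot c)$ and $\alpha(a\cdot b)=\alpha(a)\cdot\alpha(b)$. It is regular if $\alpha$ is invertible (standing assumption). A one-parameter formal deformation of $A$ is a pair of a $\mathbb{K}[[t]]$-bilinear map $\nu_t=\sum_{i\ge0}\nu_it^i:A[[t]]\times A[[t]]\to A[[t]]$ and a $\mathbb{K}[[t]]$-linear map $\alpha_t=\sum_{i\ge0}\alpha_it^i:A[[t]]\to A[[t]]$, with $\nu_i:A\times A\to A$ $\mathbb{K}$-bilinear, $\alpha_i:A\to A$ $\mathbb{K}$-linear, $\nu_0=\nu$, $\alpha_0=\alpha$, and for all $a,b,c\in A$: $\nu_t(\nu_t(a,b),\alpha_t(c))-\nu_t(\alpha_t(a),\nu_t(b,c))=\nu_t(\nu_t(b,a),\alpha_t(c))-\nu_t(\alpha_t(b),\nu_t(a,c))$ and $\nu_t(\alpha_t(a),\alpha_t(b))=\alpha_t(\nu_t(a,b))$.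 Two deformations $(\nu_t,\alpha_t)$, $(\nu'_t,\alpha'_t)$ are equivalent if there is a $\mathbb{K}[[t]]$-isomorphism $\Psi_t=\sum_{i\ge0}\psi_it^i:A[[t]]\to A[[t]]$ with $\psi_0=\mathrm{id}$ and $\psi_i:A\to A$ $\mathbb{K}$-linear such that $\Psi_t\circ\nu'_t=\nu_t\circ(\Psi_t\otimes\Psi_t)$ and $\alpha_t\circ\Psi_t=\Psi_t\circ\alpha'_t$. A deformation is trivial if it is equivalent to $(\nu_0,\alpha_0)$; $A$ is rigid if all its formal deformations are trivial. $\alpha$-type cohomology in low degree: $\widetilde C^1(A,A)=\mathrm{Hom}(A,A)$, $\widetilde C^2(A,A)=\mathrm{Hom}(A^{\otimes2},A)\oplus\mathrm{Hom}(A,A)$, $\widetilde C^3(A,A)=\mathrm{Hom}(A^{\otimes3},A)\oplus\mathrm{Hom}(A^{\otimes2},A)$. The map $\widetilde\partial:\widetilde C^1\to\widetilde C^2$ sends $\phi$ to the pair of $(a,b)\mapsto a\cdot\phi(b)+\phi(a)\cdot b-\phi(a\cdot b)$ and $a\mapsto\alpha(\phi(a))-\phi(\alpha(a))$. The map $\widetilde\partial:\widetilde C^2\to\widetilde C^3$ is $\widetilde\partial(\varphi,\psi)=(\widetilde\partial_{\nu\nu}\varphi-\widetilde\partial_{\alpha\nu}\psi,\ \widetilde\partial_{\nu\alpha}\varphi-\widetilde\partial_{\alpha\alpha}\psi)$, where $(\widetilde\partial_{\nu\nu}\varphi)(a,b,c)=\alpha(a)\cdot\varphi(b,c)-\alpha(b)\cdot\varphi(a,c)+\varphi(b,a)\cdot\alpha(c)-\varphi(a,b)\cdot\alpha(c)-\varphi(\alpha(b),a\cdot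 c)+\varphi(\alpha(a),b\cdot c)-\varphi(a\cdot b,\alpha(c))+\varphi(b\cdot a,\alpha(c))$; $(\widetilde\partial_{\alpha\nu}\psi)(a,b,c)=\psi(b)\cdot(a\cdot c)-\psi(a)\cdot(b\cdot c)+(a\cdot b)\cdot\psi(c)-(b\cdot a)\cdot\psi(c)$; $(\widetilde\partial_{\nu\alpha}\varphi)(a,b)=\alpha(\varphi(a,b))-\varphi(\alpha(a),\alpha(b))$; $(\widetilde\partial_{\alpha\alpha}\psi)(a,b)=\alpha(a)\cdot\psi(b)+\psi(a)\cdot\alpha(b)-\psi(a\cdot b)$. $\widetilde H^2(A,A)=\ker(\widetilde\partial:\widetilde C^2\to\widetilde C^3)/\widetilde\partial(\widetilde C^1)$. *)

(* Defs.v *)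
From mathcomp Require Import all_boot all_algebra.
From mathcomp Require Import boolp classical_sets functions.

Set Implicit Arguments.
Unset Strict Implicit.
Unset Printing Implicit Defensive.

Import GRing.Theory.

Local Open Scope classical_set_scope.
Local Open Scope ring_scope.

Definition is_bilinear (K : fieldType) (A : lmodType K) (f : A -> A -> A) :
    Prop :=
  (forall b, linear (f^~ b)) /\ (forall a, linear (f a)).

Record homPreLie (K : fieldType) (A : lmodType K) := HomPreLie {
  hmul : A -> A -> A;
  htwist : A -> A;
  hmul_bilinear : is_bilinear hmul;
  htwist_linear : linear htwist;
  hom_pre_lie : forall a b c,
    hmul (hmul a b) (htwist c) - hmul (htwist a) (hmul b c)
    = hmul (hmul b a) (htwist c) - hmul (htwist b) (hmul a c);
  htwist_mul : forall a b, htwist (hmul a b) = hmul (htwist a) (htwist b)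
}.

Definition regular (K : fieldType) (A : lmodType K) (L : homPreLie A) : Prop :=
  bijective (htwist L).

(* A[[t]]; the coefficient of t^n in f is f n.  The additive structure is the
   pointwise one on functions. *)
Notation series A := (nat -> A) (only parsing).

Section Series.
Context (K : fieldType) (A : lmodType K).
Implicit Types (c : series K) (f g : series A).

Definition sconst (a : A) : series A := fun n => if n is 0%N then a else 0.

Definition sscale c f : series A :=
  fun n => \sum_(i < n.+1) c i *: f (n - i)%N.

(* The maps \sum_i F_i t^i and \sum_i N_i t^i on A[[t]]. *)
Definition slin (F : nat -> A -> A) f : series A :=
  fun n => \sum_(i < n.+1) F i (f (n - i)%N).

Definition sbilin (N : nat -> A -> A -> A) f g : series A :=
  fun n => \sum_(i < n.+1) \sum_(j < (n - i).+1) N i (f j) (g (n - i - j)%N).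

Definition slinear (T : series A -> series A) : Prop :=
  (forall f g, T (f + g) = T f + T g) /\
  (forall c f, T (sscale c f) = sscale c (T f)).

Definition sbilinear (T : series A -> series A -> series A) : Prop :=
  (forall g, slinear (T^~ g)) /\ (forall f, slinear (T f)).

Lemma linear_add (f : A -> A) : linear f -> {morph f : x y / x + y}.
Proof. by move=> lf x y; have := lf 1 x y; rewrite !scale1r. Qed.

Lemma linear_zero (f : A -> A) : linear f -> f 0 = 0.
Proof.
move=> lf; have := linear_add lf 0 0.
by rewrite addr0 -{1}[f 0]addr0 => /addrI.
Qed.

Lemma linear_scale (f : A -> A) : linear f -> forall k, {morph f : x / k *: x}.
Proof.
by move=> lf k x; have := lf k x 0; rewrite !addr0 (linear_zero lf) addr0.
Qed.

Lemma linear_opp (f : A -> A) : linear f -> {morph f : x / - x}.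
Proof. by move=> lf x; rewrite -scaleN1r (linear_scale lf) scaleN1r. Qed.

Lemma linear_sum (f : A -> A) : linear f ->
  forall (I : Type) (r : seq I) (P : pred I) (E : I -> A),
  f (\sum_(i <- r | P i) E i) = \sum_(i <- r | P i) f (E i).
Proof.
by move=> lf I r P E; apply: (big_morph f (linear_add lf) (linear_zero lf)).
Qed.

Lemma sum_triangle (n : nat) (G : nat -> nat -> A) :
  \sum_(i < n.+1) \sum_(j < (n - i).+1) G i j
  = \sum_(j < n.+1) \sum_(i < (n - j).+1) G i j.
Proof.
have E (H : nat -> nat -> A) : \sum_(i < n.+1) \sum_(j < (n - i).+1) H i j
    = \sum_(i < n.+1) \sum_(j < n.+1 | (i + j <= n)%N) H i j.
  apply: eq_bigr => i _.
  have le : ((n - i).+1 <= n.+1)%N by rewrite ltnS leq_subr.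
  rewrite (big_ord_widen _ (H i) le); apply: eq_bigl => j.
  by rewrite ltnS leq_subRL // -ltnS.
rewrite E (E (fun j i => G i j)) (exchange_big_dep predT) //=.
by apply: eq_bigr => j _; apply: eq_bigl => i; rewrite addnC.
Qed.

Lemma slin_slinear F : (forall i, linear (F i)) -> slinear (slin F).
Proof.
move=> lF; split=> [f g|c f]; apply/funext => n.
  rewrite -[RHS]big_split; apply: eq_bigr => i _.
  exact: (linear_add (lF i)).
rewrite /slin /sscale.
under eq_bigr => i _ do rewrite (linear_sum (lF i)).
rewrite (sum_triangle n (fun i j => F i (c j *: f (n - i - j)%N))).
apply: eq_bigr => j _; rewrite scaler_sumr; apply: eq_bigr => i _.
by rewrite (linear_scale (lF i)) -!subnDA addnC.
Qed.

Lemma sbilin_sbilinear N : (forall i, is_bilinear (N i)) ->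
  sbilinear (sbilin N).
Proof.
move=> bN; split=> [g|f]; split=> [f1 f2|c f1]; apply/funext => n /=.
- rewrite -[RHS]big_split; apply: eq_bigr => i _.
  rewrite -big_split; apply: eq_bigr => j _.
  exact: (linear_add ((bN i).1 _)).
- rewrite /sbilin /sscale.
  transitivity (\sum_(i < n.+1) \sum_(l < (n - i).+1)
      \sum_(j < (n - i - l).+1) c l *: N i (f1 j) (g (n - i - l - j)%N)).
    apply: eq_bigr => i _; set m := (n - i)%N.
    rewrite (reindex_inj rev_ord_inj) /=.
    transitivity (\sum_(j < m.+1) \sum_(l < (m - j).+1)
       c l *: N i (f1 (m - j - l)%N) (g j)).
      apply: eq_bigr => j _; have jm : (j <= m)%N by rewrite -ltnS.
      rewrite subSS subKn // (linear_sum ((bN i).1 _)).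
      by apply: eq_bigr => l _; rewrite (linear_scale ((bN i).1 _)).
    rewrite (sum_triangle m (fun j l =>
       c l *: N i (f1 (m - j - l)%N) (g j))).
    apply: eq_bigr => l _; rewrite (reindex_inj rev_ord_inj) /=.
    apply: eq_bigr => j _; rewrite subSS.
    have jl : (j <= m - l)%N by rewrite -ltnS.
    by rewrite -subnDA addnC subnDA subKn // -!subnDA.
  rewrite (sum_triangle n (fun i l => \sum_(j < (n - i - l).+1)
      c l *: N i (f1 j) (g (n - i - l - j)%N))).
  apply: eq_bigr => l _; rewrite scaler_sumr; apply: eq_bigr => i _.
  by rewrite scaler_sumr -!subnDA [(i + l)%N]addnC.
- rewrite -[RHS]big_split; apply: eq_bigr => i _.
  rewrite -big_split; apply: eq_bigr => j _.
  exact: (linear_add ((bN i).2 _)).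
- rewrite /sbilin /sscale.
  transitivity (\sum_(i < n.+1) \sum_(l < (n - i).+1)
      \sum_(j < (n - i - l).+1) c l *: N i (f j) (f1 (n - i - l - j)%N)).
    apply: eq_bigr => i _; set m := (n - i)%N.
    under eq_bigr => j _ do rewrite (linear_sum ((bN i).2 _)).
    rewrite (sum_triangle m (fun j l =>
       N i (f j) (c l *: f1 (m - j - l)%N))).
    apply: eq_bigr => l _; apply: eq_bigr => j _.
    by rewrite (linear_scale ((bN i).2 _)) -!subnDA addnC.
  rewrite (sum_triangle n (fun i l => \sum_(j < (n - i - l).+1)
      c l *: N i (f j) (f1 (n - i - l - j)%N))).
  apply: eq_bigr => l _; rewrite scaler_sumr; apply: eq_bigr => i _.
  by rewrite scaler_sumr -!subnDA [(i + l)%N]addnC.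
Qed.

End Series.

Section Deformation.
Context (K : fieldType) (A : lmodType K) (L : homPreLie A).

(* The coefficients nu_i and alpha_i determine nu_t and alpha_t, which are
   automatically K[[t]]-(bi)linear by sbilin_sbilinear and slin_slinear. *)
Record deformation := Deformation {
  dnu : nat -> A -> A -> A;
  dalpha : nat -> A -> A;
  dnu_bilinear : forall i, is_bilinear (dnu i);
  dalpha_linear : forall i, linear (dalpha i);
  dnu0 : dnu 0 = hmul L;
  dalpha0 : dalpha 0 = htwist L;
  deformation_pre_lie : forall a b c : A,
    let nut := sbilin dnu in
    let alphat := slin dalpha in
    let a := sconst a in let b := sconst b in let c := sconst c in
    nut (nut a b) (alphat c) - nut (alphat a) (nut b c)
    = nut (nut b a) (alphat c) - nut (alphat b) (nut a c);
  deformation_mul : forall a b : A,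
    let nut := sbilin dnu in
    let alphat := slin dalpha in
    let a := sconst a in let b := sconst b in
    nut (alphat a) (alphat b) = alphat (nut a b)
}.

(* Psi_t = slin psi is K[[t]]-linear by slin_slinear. *)
Definition equivalent (d d' : deformation) : Prop :=
  exists psi : nat -> A -> A,
    let Psi := slin psi in
    [/\ forall i, linear (psi i),
        psi 0%N = id,
        bijective Psi,
        forall f g : series A,
          Psi (sbilin (dnu d') f g) = sbilin (dnu d) (Psi f) (Psi g)
      & forall f : series A,
          slin (dalpha d) (Psi f) = Psi (slin (dalpha d') f)].

Definition trivial_nu (i : nat) : A -> A -> A :=
  if i is 0%N then hmul L else fun _ _ => 0.

Definition trivial_alpha (i : nat) : A -> A :=
  if i is 0%N then htwist L else fun=> 0.

Lemma trivial_nu_bilinear i : is_bilinear (trivial_nu i).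
Proof.
case: i => [|i]; first exact: hmul_bilinear.
by split=> x k y z; rewrite scaler0 addr0.
Qed.

Lemma trivial_alpha_linear i : linear (trivial_alpha i).
Proof.
case: i => [|i]; first exact: htwist_linear.
by move=> k y z; rewrite scaler0 addr0.
Qed.

Lemma slin_trivial a : slin trivial_alpha (sconst a) = sconst (htwist L a).
Proof.
apply/funext => n; rewrite /slin big_ord_recl big1 ?addr0 //= subn0.
by case: n => //= n; exact: (linear_zero (htwist_linear L)).
Qed.

Lemma sbilin_trivial a b :
  sbilin trivial_nu (sconst a) (sconst b) = sconst (hmul L a b).
Proof.
have [bl br] := hmul_bilinear L.
apply/funext => n; rewrite /sbilin big_ord_recl [X in _ + X]big1 => [|i _].
  rewrite addr0 big_ord_recl big1 ?addr0 /= => [|j _].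
    by rewrite !subn0; case: n => //= n; exact: (linear_zero (br _)).
  exact: (linear_zero (bl _)).
by rewrite big1.
Qed.

Lemma sconstB (a b : A) : sconst a - sconst b = sconst (a - b).
Proof. by apply/funext => -[|n] //; apply: subr0. Qed.

Lemma trivial_pre_lie (a b c : A) :
  let nut := sbilin trivial_nu in
  let alphat := slin trivial_alpha in
  let a := sconst a in let b := sconst b in let c := sconst c in
  nut (nut a b) (alphat c) - nut (alphat a) (nut b c)
  = nut (nut b a) (alphat c) - nut (alphat b) (nut a c).
Proof. by rewrite /= !(slin_trivial, sbilin_trivial) !sconstB hom_pre_lie. Qed.

Lemma trivial_mul (a b : A) :
  let nut := sbilin trivial_nu in
  let alphat := slin trivial_alpha in
  let a := sconst a in let b := sconst b in
  nut (alphat a) (alphat b) = alphat (nut a b).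
Proof. by rewrite /= !(slin_trivial, sbilin_trivial) htwist_mul. Qed.

Definition trivial_deformation : deformation :=
  Deformation trivial_nu_bilinear trivial_alpha_linear erefl erefl
    trivial_pre_lie trivial_mul.

Definition rigid : Prop :=
  forall d : deformation, equivalent d trivial_deformation.

End Deformation.

Section Cohomology.
Context (K : fieldType) (A : lmodType K) (L : homPreLie A).
Local Notation "a ** b" := (hmul L a b) (at level 40, left associativity).
Local Notation alpha := (htwist L).

(* Cochains are (pairs of) multilinear maps inside the full function spaces. *)
Definition C1 : set (A -> A) := [set phi | linear phi].

Definition C2 : set ((A -> A -> A) * (A -> A)) :=
  [set c | is_bilinear c.1 /\ linear c.2].

Definition d1 (phi : A -> A) : (A -> A -> A) * (A -> A) :=
  (fun a b => a ** phi b + phi a ** b - phi (a ** b),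
   fun a => alpha (phi a) - phi (alpha a)).

Definition d_nu_nu (phi : A -> A -> A) : A -> A -> A -> A := fun a b c =>
  alpha a ** phi b c - alpha b ** phi a c
  + phi b a ** alpha c - phi a b ** alpha c
  - phi (alpha b) (a ** c) + phi (alpha a) (b ** c)
  - phi (a ** b) (alpha c) + phi (b ** a) (alpha c).

Definition d_alpha_nu (psi : A -> A) : A -> A -> A -> A := fun a b c =>
  psi b ** (a ** c) - psi a ** (b ** c)
  + (a ** b) ** psi c - (b ** a) ** psi c.

Definition d_nu_alpha (phi : A -> A -> A) : A -> A -> A := fun a b =>
  alpha (phi a b) - phi (alpha a) (alpha b).

Definition d_alpha_alpha (psi : A -> A) : A -> A -> A := fun a b =>
  alpha a ** psi b + psi a ** alpha b - psi (a ** b).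

Definition d2 (c : (A -> A -> A) * (A -> A)) :
    (A -> A -> A -> A) * (A -> A -> A) :=
  (d_nu_nu c.1 - d_alpha_nu c.2, d_nu_alpha c.1 - d_alpha_alpha c.2).

Definition Z2 : set ((A -> A -> A) * (A -> A)) := C2 `&` [set c | d2 c = 0].

Definition B2 : set ((A -> A -> A) * (A -> A)) := d1 @` C1.

Definition coset2 (z : (A -> A -> A) * (A -> A)) :
    set ((A -> A -> A) * (A -> A)) :=
  [set z + b | b in B2].

Definition H2 : set (set ((A -> A -> A) * (A -> A))) := coset2 @` Z2.

Definition H2_zero : Prop := H2 = [set coset2 0].

End Cohomology.

(* Main.v *)
Require Import Defs.
From mathcomp Require Import all_boot all_algebra.
From mathcomp Require Import boolp classical_sets functions.

Set Implicit Arguments.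
Unset Strict Implicit.
Unset Printing Implicit Defensive.

Import GRing.Theory.
Local Open Scope ring_scope.

(** A deformation (nu_t, alpha_t) is trivial as soon as there is a series
Psi = \sum_i psi_i t^i with psi_0 = id such that, for all a and b in A,
  nu_t (Psi a, Psi b) = Psi (a . b)   and   alpha_t (Psi a) = Psi (alpha a).
The coefficients psi_n are found one after the other.

Suppose that both equations hold below t^n, for some n > 0.  Put psi_n = 0 and
let E(a, b) and F(a) be the t^n-coefficients of the differences of the two
sides ([nu_defect] and [alpha_defect]).  Another choice of psi_n changes
(E, F) by d1 psi_n, so psi_n can be found once (E, F) is a coboundary.  As H^2
vanishes, it suffices that (E, F) is a cocycle ([defect_cocycle]).  For this,
evaluate the two identities that define a deformation at the series Psi a,
Psi b, Psi c.  Modulo t^(n+1), each inner term nu_t (Psi a, Psi b) or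
alpha_t (Psi a) is Psi (a . b) + t^n E(a, b) or Psi (alpha a) + t^n F(a).
Expanding the outer operation, the t^n-coefficient is psi_n applied to the
corresponding identity of A, which vanishes, plus the expression of E and F
that the cocycle condition requires to be 0.  Comparing nu_t (Psi a, Psi b)
with Psi (a . b) directly, instead of conjugating nu_t by Psi, avoids both the
inverse of Psi and the convergence of an infinite product of gauge
transformations.

The identities of a deformation are given on constants only; they extend to
A[[t]] because a K[[t]]-linear map is determined by its values on constants
([slinear_ext]).  The successive choices are made by dependent choice
([coefficientwise_construction]), which also yields the surjectivity of Psi. *)

(** * Choosing the coefficients of a series one at a time *)

Definition cut (T : Type) (f : nat -> T) (n : nat) (x : T) : nat -> T :=
  fun k => if (k < n)%N then f k else x.

Lemma cut_lt (T : Type) (f : nat -> T) n x k : (k < n)%N -> cut f n x k = f k.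
Proof. by rewrite /cut => ->. Qed.

Lemma cut_last (T : Type) (f : nat -> T) n x : cut f n x n = x.
Proof. by rewrite /cut ltnn. Qed.

(** Dependent choice for conditions R n that involve only the coefficients of
index at most n. *)
Lemma coefficientwise_construction (T : Type) (R : nat -> (nat -> T) -> Prop) :
    inhabited T ->
    (forall n f g, (forall k, (k <= n)%N -> f k = g k) -> R n f -> R n g) ->
    (forall n f, (forall k, (k < n)%N -> R k f) -> exists x, R n (cut f n x)) ->
  exists f, forall n, R n f.
Proof.
move=> [x0] Rloc Rstep.
have /choice [s sP] (nf : nat * (nat -> T)) : exists x,
    (forall k, (k < nf.1)%N -> R k nf.2) -> R nf.1 (cut nf.2 nf.1 x).
  case: (pselect (forall k, (k < nf.1)%N -> R k nf.2)) => [/Rstep [x Rx]|nR].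
    by exists x.
  by exists x0 => /nR.
(* p n has the final coefficients below n, so the value chosen by s from p n is
   never changed afterwards. *)
pose p := fix p n := if n is m.+1 then cut (p m) m (s (m, p m)) else fun=> x0.
pose f n := p n.+1 n.
have pf n k : (k < n)%N -> p n k = f k.
  elim: n => // n IHn; rewrite ltnS leq_eqVlt => /predU1P [-> //|kn].
  by rewrite /= cut_lt // IHn.
exists f; elim/ltn_ind => n IHn.
apply: (Rloc n (p n.+1)) => [k kn|]; first exact: pf.
apply: (sP (n, p n)) => k kn /=; apply: (Rloc k f) => [j jk|]; last exact: IHn.
by rewrite pf // (leq_ltn_trans jk).
Qed.

(** * Linear maps on formal power series *)

Section SeriesMaps.
Context (K : fieldType) (A : lmodType K).
Implicit Types (S T : series A -> series A) (f g : series A).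
Implicit Types (psi : nat -> A -> A).

Lemma linear_sub (f g : A -> A) :
  linear f -> linear g -> linear (fun x => f x - g x).
Proof. by move=> lf lg k x y; rewrite lf lg scalerBr opprD addrACA. Qed.

Lemma sscaleB (c : series K) f g : sscale c (f - g) = sscale c f - sscale c g.
Proof.
apply/funext => n; rewrite /sscale -[RHS]sumrB.
by apply: eq_bigr => i _; rewrite -scalerBr.
Qed.

Lemma slinear_sub S T : slinear S -> slinear T -> slinear (fun f => S f - T f).
Proof.
move=> [SD SZ] [TD TZ]; split=> [f g|c f].
  by rewrite SD TD opprD addrACA.
by rewrite SZ TZ sscaleB.
Qed.

Lemma slinear_comp S T : slinear S -> slinear T -> slinear (fun f => S (T f)).
Proof. by move=> [SD SZ] [TD TZ]; split=> *; rewrite (TD, TZ) (SD, SZ). Qed.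

(** The variable t of K[[t]]. *)
Definition sX : series K := fun n => (n == 1%N)%:R.

Lemma series_split f : f = sconst (f 0%N) + sscale sX (fun n => f n.+1).
Proof.
apply/funext => -[|n].
  rewrite [RHS]/GRing.add /= /sscale big_ord1 /sX /=.
  by rewrite scale0r addr0.
rewrite [RHS]/GRing.add /= /sscale 2!big_ord_recl big1 => [|i _].
  by rewrite /sX /= scale0r scale1r !add0r addr0 subn1.
by rewrite /sX /= scale0r.
Qed.

(** Write f = f_0 + t g.  Two linear maps that agree on f_0 differ at f by t times
their difference at g, so the t^n-coefficients agree by induction on n; no
continuity is assumed. *)
Lemma slinear_ext S T : slinear S -> slinear T ->
  (forall a, S (sconst a) = T (sconst a)) -> forall f, S f = T f.
Proof.
move=> [SD SZ] [TD TZ] ST f; apply/funext => n.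
elim/ltn_ind: n f => n IHn f.
rewrite (series_split f) SD TD SZ TZ ST; congr (_ + _).
(* The coefficient of t^0 in t is 0, so only lower coefficients contribute. *)
apply: eq_bigr => i _; case: (posnP i) => [->|i0]; first by rewrite !scale0r.
by rewrite IHn // ltn_subrL i0 (leq_trans i0) // -ltnS.
Qed.

Lemma slin_sconst psi a : (forall i, linear (psi i)) ->
  slin psi (sconst a) = (fun n => psi n a).
Proof.
move=> lpsi; apply/funext => n; rewrite /slin big_ord_recr big1 /= ?subnn ?add0r //.
move=> i _; have : (0 < n - i)%N by rewrite subn_gt0.
by case: (n - i)%N => // m _; exact: linear_zero.
Qed.

Lemma slin_perturb psi f g n : linear (psi 0%N) ->
    (forall k, (k < n)%N -> f k = g k) ->
  slin psi f n = slin psi g n + psi 0%N (f n - g n).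
Proof.
move=> l0 fg; rewrite /slin !big_ord_recl /= !subn0.
rewrite (linear_add l0) (linear_opp l0) [RHS]addrC -addrA; congr (_ + _).
rewrite addKr; apply: eq_bigr => i _; rewrite fg // ltn_subrL /=.
by rewrite (leq_ltn_trans (leq0n i)).
Qed.

(** Arguments changed from order t^n on: the t^n-coefficient then changes by the
linearization of N_0 at the constant terms.  The product of the two changes is
of order t^(2n), whence n > 0. *)
Lemma sbilin_perturb (N : nat -> A -> A -> A) f f' g g' n :
    is_bilinear (N 0%N) -> (0 < n)%N ->
    (forall k, (k < n)%N -> f k = f' k) -> (forall k, (k < n)%N -> g k = g' k) ->
  sbilin N f g n =
    sbilin N f' g' n + (N 0%N (f n - f' n) (g' 0%N) + N 0%N (f' 0%N) (g n - g' n)).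
Proof.
case: n => // n [bl br] _ ff' gg'; rewrite /sbilin.
have lt (k m : nat) : (k <= n - m)%N -> (k < n.+1)%N.
  by move=> km; rewrite ltnS (leq_trans km) ?leq_subr.
rewrite big_ord_recl [X in _ = X + _]big_ord_recl [in RHS]addrAC; congr (_ + _).
  (* In the row of N_0, only the two extreme terms involve a last coefficient. *)
  rewrite !subn0 /= big_ord_recl [X in _ + X = _]big_ord_recr.
  rewrite [X in _ = X + _]big_ord_recl [X in _ = _ + X + _]big_ord_recr /=.
  rewrite !subn0 /bump /= !add1n subnn.
  rewrite (ff' 0%N) // (gg' 0%N) //.
  rewrite (linear_add (bl _)) (linear_opp (bl _)).
  rewrite (linear_add (br _)) (linear_opp (br _)).
  rewrite (eq_bigr (fun j : 'I_n => N 0%N (f' (1 + j)%N) (g' (n.+1 - (1 + j))%N)))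
    => [|j _].
    by rewrite [RHS](AC ((1*2)*(2*2)) (6*(2*4)*(1*7)*(3*5))) /= !subrr !addr0.
  rewrite ff' ?gg' //; last by rewrite add1n ltnS.
  by rewrite add1n subSS ltnS leq_subr.
apply: eq_bigr => i _; apply: eq_bigr => j _.
have jn : (j <= n - i)%N by move: (ltn_ord j); rewrite ltnS.
rewrite ff' ?gg' //; last exact: lt jn.
by rewrite ltnS (leq_trans (leq_subr _ _)) // /= /bump add1n subSS leq_subr.
Qed.

Lemma sbilin_linearl (N : nat -> A -> A -> A) psi g n :
    (forall i, is_bilinear (N i)) -> (forall i, linear (psi i)) ->
  linear (fun a => sbilin N (fun k => psi k a) g n).
Proof.
move=> bN lpsi k x y; rewrite /sbilin scaler_sumr -big_split.
apply: eq_bigr => i _; rewrite scaler_sumr -big_split; apply: eq_bigr => j _ /=.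
by rewrite lpsi ((bN i).1 _).
Qed.

Lemma sbilin_linearr (N : nat -> A -> A -> A) psi f n :
    (forall i, is_bilinear (N i)) -> (forall i, linear (psi i)) ->
  linear (fun a => sbilin N f (fun k => psi k a) n).
Proof.
move=> bN lpsi k x y; rewrite /sbilin scaler_sumr -big_split.
apply: eq_bigr => i _; rewrite scaler_sumr -big_split; apply: eq_bigr => j _ /=.
by rewrite lpsi ((bN i).2 _).
Qed.

Lemma slin_linear (F : nat -> A -> A) psi n :
    (forall i, linear (F i)) -> (forall i, linear (psi i)) ->
  linear (fun a => slin F (fun k => psi k a) n).
Proof.
move=> lF lpsi k x y; rewrite /slin scaler_sumr -big_split.
by apply: eq_bigr => i _ /=; rewrite lpsi lF.
Qed.

(** As psi_0 = id, the t^n-coefficient of Psi f is f_n plus a function of the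
lower coefficients of f: Psi f = g has exactly one solution. *)
Lemma slin_bijective psi : (forall i, linear (psi i)) -> psi 0%N = id ->
  bijective (slin psi).
Proof.
move=> lpsi psi0.
have inj f g : slin psi f = slin psi g -> f = g.
  move=> fg; apply/funext; elim/ltn_ind => n IHn.
  have := congr1 (@^~ n) fg; rewrite /= (slin_perturb (lpsi 0%N) IHn) psi0.
  by rewrite -[X in _ = X]addr0 => /addrI /eqP; rewrite subr_eq0 => /eqP.
have /choice [inv invK] g : exists f, slin psi f = g.
  suff [f fP] : exists f, forall n, slin psi f n = g n.
    by exists f; apply/funext.
  apply: (coefficientwise_construction (R := fun n f => slin psi f n = g n)).
  - exact: (inhabits 0).
  - move=> n f f' ff' <-; apply: eq_bigr => i _; congr (psi i _).
    by rewrite ff' // leq_subr.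
  - move=> n f _; exists (g n - slin psi (cut f n 0) n).
    have E k : (k < n)%N ->
        cut f n (g n - slin psi (cut f n 0) n) k = cut f n 0 k.
      by move=> kn; rewrite !cut_lt.
    by rewrite (slin_perturb (lpsi 0%N) E) !cut_last psi0 subr0 addrC subrK.
exists inv => [f|//]; exact/inj/invK.
Qed.

End SeriesMaps.

(** * The obstruction to extending an equivalence by one order *)

(** A vanishing H2 has one coset only, so that of z is the coset of 0, and it
contains z. *)
Lemma H2_zero_coboundary (K : fieldType) (A : lmodType K) (L : homPreLie A) z :
  H2_zero L -> Z2 L z -> exists2 phi, linear phi & d1 L phi = z.
Proof.
move=> H20 Zz.
have Hz : H2 L (coset2 L z) by exists z.
have d10 : d1 L (fun=> 0) = 0.
  congr pair; apply/funext => a; last by rewrite (linear_zero (htwist_linear L)) subr0.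
  apply/funext => b; rewrite (linear_zero ((hmul_bilinear L).1 _)).
  by rewrite (linear_zero ((hmul_bilinear L).2 _)) addr0 subr0.
have zz : coset2 L z z.
  exists 0; last exact: addr0.
  by exists (fun=> 0) => // k x y; rewrite scaler0 addr0.
rewrite /H2_zero in H20; rewrite H20 in Hz; rewrite Hz in zz.
by case: zz => _ [phi lphi <-]; rewrite add0r => <-; exists phi.
Qed.

Section Obstruction.
Context (K : fieldType) (A : lmodType K) (L : homPreLie A) (d : deformation L).
Local Notation nut := (sbilin (dnu d)).
Local Notation alphat := (slin (dalpha d)).
Local Notation "a ** b" := (hmul L a b) (at level 40, left associativity).
Local Notation alpha := (htwist L).

Lemma deformation_pre_lie_series f g h :
  nut (nut f g) (alphat h) - nut (alphat f) (nut g h)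
  = nut (nut g f) (alphat h) - nut (alphat g) (nut f h).
Proof.
have [bl br] := sbilin_sbilinear (dnu_bilinear d).
have la := slin_slinear (dalpha_linear d).
have nl T g' : slinear T -> slinear (fun f => nut (T f) g').
  exact: (slinear_comp (bl g')).
have nr T g' : slinear T -> slinear (fun f => nut g' (T f)).
  exact: (slinear_comp (br g')).
move: f; apply: slinear_ext => [||a].
- by apply: slinear_sub; apply: nl => //; exact: bl.
- by apply: slinear_sub; [apply: nl; exact: br|apply: nr; exact: bl].
move: g; apply: slinear_ext => [||b].
- by apply: slinear_sub; [apply: nl; exact: br|apply: nr; exact: bl].
- by apply: slinear_sub; apply: nl => //; exact: bl.
move: h; apply: slinear_ext => [||c]; last exact: deformation_pre_lie.
- by apply: slinear_sub; apply: nr => //; exact: br.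
- by apply: slinear_sub; apply: nr => //; exact: br.
Qed.

Lemma deformation_mul_series f g :
  nut (alphat f) (alphat g) = alphat (nut f g).
Proof.
have [bl br] := sbilin_sbilinear (dnu_bilinear d).
have la := slin_slinear (dalpha_linear d).
move: f; apply: slinear_ext => [||a].
- exact: (slinear_comp (bl _) la).
- exact: (slinear_comp la (bl _)).
move: g; apply: slinear_ext => [||b]; last exact: deformation_mul.
- exact: (slinear_comp (br _) la).
- exact: (slinear_comp la (br _)).
Qed.

(** The t^n-coefficients of nu_t (Psi a, Psi b) - Psi (a . b) and of
alpha_t (Psi a) - Psi (alpha a), where Psi a = \sum_k psi_k(a) t^k. *)
Definition nu_defect (psi : nat -> A -> A) (n : nat) (a b : A) : A :=
  nut (fun k => psi k a) (fun k => psi k b) n - psi n (a ** b).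

Definition alpha_defect (psi : nat -> A -> A) (n : nat) (a : A) : A :=
  alphat (fun k => psi k a) n - psi n (alpha a).

Definition intertwines_at (n : nat) (psi : nat -> A -> A) : Prop :=
  [/\ n = 0%N -> psi 0%N = id, linear (psi n),
      forall a b, nu_defect psi n a b = 0
    & forall a, alpha_defect psi n a = 0].

(** The hypothesis is the t^n-coefficient of the Hom-pre-Lie identity of nu_t at
Psi a, Psi b, Psi c, and the conclusion the first component of d2.  The p's are
values of psi_n and the e's values of [nu_defect].  The x's and y's are products
with a defect as left and right factor: of nu for x1, x3, y2, y4 and of alpha
for the others. *)
Lemma pre_lie_defect_rearrangement (p1 p2 p3 p4 e1 e2 e3 e4 x1 x2 x3 x4
    y1 y2 y3 y4 : A) :
    p1 - p2 = p3 - p4 ->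
    p1 + (e1 + (x1 + y1)) - (p2 + (e2 + (x2 + y2)))
    = p3 + (e3 + (x3 + y3)) - (p4 + (e4 + (x4 + y4))) ->
  y2 - y4 + x3 - x1 - e4 + e2 - e1 + e3 - (x4 - x2 + y1 - y3) = 0.
Proof.
move=> pE; rewrite !opprD [LHS]addrACA [RHS]addrACA pE => /addrI /eqP.
rewrite eq_sym -subr_eq0 => /eqP <-.
rewrite !(opprD, opprK) !addrA.
by rewrite [LHS](ACl (8*3*12*5*9*2*7*4*11*6*10*1)).
Qed.

(** The same bookkeeping for the multiplicativity of alpha_t. *)
Lemma mul_defect_rearrangement (e x y z w : A) :
  e + (x + y) = z + w -> w - e - (y + x - z) = 0.
Proof.
by move=> H; rewrite opprB addrACA -opprD [y + x]addrC H [w + z]addrC subrr.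
Qed.

(** Each identity of a deformation at Psi a, Psi b, Psi c has inner terms known
modulo t^(n+1) up to one defect each; the outer operation adds its own defect.
The values of psi_n cancel by the identities of L. *)
Lemma defect_cocycle psi n : (0 < n)%N -> psi 0%N = id ->
    (forall i, linear (psi i)) ->
    (forall k, (k < n)%N -> forall a b, nu_defect psi k a b = 0) ->
    (forall k, (k < n)%N -> forall a, alpha_defect psi k a = 0) ->
  Z2 L (nu_defect psi n, alpha_defect psi n).
Proof.
move=> n0 psi0 lpsi nu_lt alpha_lt.
pose P a k := psi k a.
have [bl br] := hmul_bilinear L.
have b0 : is_bilinear (dnu d 0%N) by exact: dnu_bilinear.
have l0 : linear (dalpha d 0%N) by exact: dalpha_linear.
have Pnu a b k : (k < n)%N -> nut (P a) (P b) k = P (a ** b) k.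
  by move=> kn; apply/eqP; rewrite -subr_eq0; apply/eqP; exact: nu_lt.
have Palpha a k : (k < n)%N -> alphat (P a) k = P (alpha a) k.
  by move=> kn; apply/eqP; rewrite -subr_eq0; apply/eqP; exact: alpha_lt.
have nuE a b : nut (P a) (P b) n = P (a ** b) n + nu_defect psi n a b.
  by rewrite addrC subrK.
have alphaE a : alphat (P a) n = P (alpha a) n + alpha_defect psi n a.
  by rewrite addrC subrK.
have perturb f g a b : (forall k, (k < n)%N -> f k = P a k) ->
    (forall k, (k < n)%N -> g k = P b k) ->
    nut f g n = P (a ** b) n + (nu_defect psi n a b
      + ((f n - P a n) ** b + a ** (g n - P b n))).
  move=> fa gb; rewrite (sbilin_perturb b0 n0 fa gb) nuE -addrA.
  by rewrite /P psi0 dnu0.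
split.
  split; first split => [b|a].
  - apply: linear_sub; first exact: sbilin_linearl (dnu_bilinear d) lpsi.
    by move=> k x y; rewrite bl lpsi.
  - apply: linear_sub; first exact: sbilin_linearr (dnu_bilinear d) lpsi.
    by move=> k x y; rewrite br lpsi.
  - apply: linear_sub; first exact: slin_linear (dalpha_linear d) lpsi.
    by move=> k x y; rewrite (htwist_linear L) lpsi.
congr pair; apply/funext => a; apply/funext => b; last first.
  have /(congr1 (@^~ n)) := deformation_mul_series (P a) (P b).
  rewrite /= (perturb _ _ (alpha a) (alpha b) (Palpha a) (Palpha b)).
  rewrite (slin_perturb l0 (Pnu a b)) dalpha0.
  rewrite [alphat (P (a ** b)) n]alphaE htwist_mul -[X in _ = X]addrA => /addrI.
  exact: mul_defect_rearrangement.
apply/funext => c.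
have /(congr1 (@^~ n)) := deformation_pre_lie_series (P a) (P b) (P c).
rewrite /= /GRing.add /GRing.opp /=.
rewrite (perturb _ _ _ _ (Pnu a b) (Palpha c)) (perturb _ _ _ _ (Pnu b a) (Palpha c)).
rewrite (perturb _ _ _ _ (Palpha a) (Pnu b c)) (perturb _ _ _ _ (Palpha b) (Pnu a c)).
apply: pre_lie_defect_rearrangement.
rewrite /P -!(linear_opp (lpsi n)) -!(linear_add (lpsi n)).
by rewrite hom_pre_lie.
Qed.

(** * Existence of the equivalence *)

Lemma intertwines_at_local n psi psi' :
    (forall k, (k <= n)%N -> psi k = psi' k) ->
  intertwines_at n psi -> intertwines_at n psi'.
Proof.
move=> E [psi0 ln nu0 alpha0].
split; rewrite -?E //; [move=> a b|move=> a].
- rewrite -(nu0 a b) /nu_defect E //; congr (_ - _).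
  apply: eq_bigr => i _; apply: eq_bigr => j _; rewrite !E //.
    by rewrite -subnDA leq_subr.
  by rewrite -ltnS (leq_trans (ltn_ord j)) // ltnS leq_subr.
- rewrite -(alpha0 a) /alpha_defect E //; congr (_ - _).
  by apply: eq_bigr => i _; rewrite E // leq_subr.
Qed.

(** Replacing psi_n = 0 by -phi adds - d1 phi to the pair of defects at order n,
so the phi to take is a primitive of that pair. *)
Lemma intertwines_at_step n psi : H2_zero L ->
    (forall k, (k < n)%N -> intertwines_at k psi) ->
  exists phi, intertwines_at n (cut psi n phi).
Proof.
move=> H20 psiP; case: (posnP n) => [->|n0].
  exists id; split=> // [a b|a].
    by rewrite /nu_defect /sbilin !big_ord1 dnu0 subrr.
  by rewrite /alpha_defect /slin big_ord1 dalpha0 subrr.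
have cutE x k : (k < n)%N -> intertwines_at k (cut psi n x).
  move=> kn; apply: (intertwines_at_local _ (psiP k kn)) => j jk.
  by rewrite cut_lt // (leq_ltn_trans jk).
have cut0 x : cut psi n x 0%N = id by case: (cutE x 0%N n0) => ->.
have lcut x : linear x -> forall k, linear (cut psi n x k).
  move=> lx k; rewrite /cut; case: ifP => // kn.
  by case: (psiP k kn).
have lin0 : linear (fun _ : A => 0 : A) by move=> k x y; rewrite scaler0 addr0.
have [|phi lphi [nuE alphaE]] := H2_zero_coboundary
    (z := (nu_defect (cut psi n (fun=> 0)) n,
           alpha_defect (cut psi n (fun=> 0)) n)) H20.
  apply: defect_cocycle => // [|k kn|k kn]; first exact: lcut.
    by case: (cutE (fun=> 0) k kn).
  by case: (cutE (fun=> 0) k kn).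
have [bl br] := hmul_bilinear L.
have agree x a k : (k < n)%N -> cut psi n x k a = cut psi n (fun=> 0) k a.
  by move=> kn; rewrite !cut_lt.
exists (fun a => - phi a); split.
- by move=> n00; rewrite n00 in n0.
- by rewrite cut_last => k x y; rewrite lphi opprD scalerN.
- move=> a b; rewrite /nu_defect.
  rewrite (sbilin_perturb (dnu_bilinear d 0%N) n0 (agree _ a) (agree _ b)).
  have := congr1 (fun F => F a b) nuE; rewrite /nu_defect /= !cut_last !subr0 => <-.
  rewrite cut0 dnu0 (linear_opp (bl _)) (linear_opp (br _)) opprK.
  by rewrite addrAC subrK -opprD [phi a ** b + _]addrC subrr.
- move=> a; rewrite /alpha_defect.
  rewrite (slin_perturb (dalpha_linear d 0%N) (agree _ a)).
  have := congr1 (fun F => F a) alphaE; rewrite /alpha_defect /= !cut_last !subr0 => <-.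
  by rewrite dalpha0 (linear_opp (htwist_linear L)) opprK addrAC subrK subrr.
Qed.

(** Defects that vanish at all orders say that Psi intertwines the two structures
on constants, which is enough by K[[t]]-linearity. *)
Lemma intertwiner_equivalent psi : (forall n, intertwines_at n psi) ->
  equivalent d (trivial_deformation L).
Proof.
move=> psiP; exists psi => /=.
have lpsi n : linear (psi n) by case: (psiP n).
have psi0 : psi 0%N = id by case: (psiP 0%N) => ->.
have lPsi := slin_slinear lpsi.
have [bl br] := sbilin_sbilinear (dnu_bilinear d).
have [tl tr] := sbilin_sbilinear (trivial_nu_bilinear L).
split=> //; first exact: slin_bijective.
- move=> f g; move: f; apply: slinear_ext => [||a].
  + exact: (slinear_comp lPsi (tl g)).
  + exact: (slinear_comp (bl (slin psi g)) lPsi).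
  move: g; apply: slinear_ext => [||b].
  + exact: (slinear_comp lPsi (tr (sconst a))).
  + exact: (slinear_comp (br (slin psi (sconst a))) lPsi).
  rewrite sbilin_trivial !slin_sconst //; apply/funext => n.
  by case: (psiP n) => _ _ /(_ a b)/eqP; rewrite subr_eq0 => /eqP <-.
- apply: slinear_ext => [||a].
  + exact: slinear_comp (slin_slinear (dalpha_linear d)) lPsi.
  + exact: slinear_comp lPsi (slin_slinear (trivial_alpha_linear L)).
  rewrite slin_trivial !slin_sconst //; apply/funext => n.
  by case: (psiP n) => _ _ _ /(_ a)/eqP; rewrite subr_eq0 => /eqP <-.
Qed.

End Obstruction.

Theorem corollary3p11 (K : fieldType) (charK0 : [pchar K]%R =i pred0)
    (A : lmodType K) (L : homPreLie A) (regL : regular L) (H20 : H2_zero L) :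
  rigid L.
Proof.
move=> d.
have [psi psiP] := coefficientwise_construction (inhabits (id : A -> A))
  (@intertwines_at_local _ _ L d) (fun n psi => intertwines_at_step H20).
exact: intertwiner_equivalent psiP.
Qed.
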